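(* In the $d$-dimensional setting with $v\equiv0$, $\beta\ge0$, $\zeta_l>0$, $\zeta_r>0$ and $N_1\ge2$, $$\mathcal{J}(N_1,\dots,N_d)=\frac{2(\alpha_{in}^l\alpha_{out}^r-\alpha_{out}^l\alpha_{in}^r)\prod_{n=2}^dN_n}{\big(\beta(N_1-1)+\zeta_l+\zeta_r\big)\zeta_l\zeta_r+\zeta_l+\zeta_r}.$$
   Context: Let $d\ge1$ and $N_1,\dots,N_d\in\mathbb{N}$. Let $\mathfrak L=\{1,\dots,N_1\}\times\cdots\times\{1,\dots,N_d\}$; $NN(\nu)$ is the set of nearest neighbours of $\nu$ in $\mathfrak L$. For $i=1,\dots,N_1$ let $M_i=\{\nu\in\mathfrak L:\nu_1=i\}$, and for $\nu\notin M_{N_1}$ let $\nu_+=(\nu_1+1,\nu_2,\dots,\nu_d)$. Let $\{e_\nu\}$ be the standard basis of $\mathbb{C}^{|\mathfrak L|}$, $p_\nu=|e_\nu\rangle\langle e_\nu|$, $P_1=\sum_{\nu\in M_1}p_\nu$, $P_{N_1}=\sum_{\nu\in M_{N_1}}p_\nu$. Given a real $v$ on $\mathfrak L$, $(h\psi)(\nu)=-\sum_{\mu\in NN(\nu)}\psi(\mu)+v(\nu)\psi(\nu)$. Let $\alpha_{in}^l,\alpha_{out}^l,\alpha_{in}^r,\alpha_{out}^r,\beta\ge0$, $\zeta_l=\alpha_{in}^l+\alpha_{out}^l$, $\zeta_r=\alpha_{in}^r+\alpha_{out}^r$. Define $l(a)=-i[h,a]-\zeta_l\{P_1,a\}-\zeta_r\{P_{N_1},a\}+\beta\left(\sum_{\nu\in\mathfrak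 L}p_\nu ap_\nu-a\right)$ on $M_{|\mathfrak L|}(\mathbb{C})$, $R_\infty=\int_0^\infty e^{tl}(2\alpha_{in}^lP_1+2\alpha_{in}^rP_{N_1})\,dt$, and the stationary current $\mathcal{J}(N_1,\dots,N_d)=\sum_{\nu\in M_1}2\,\mathrm{Im}\langle e_{\nu_+},R_\infty e_\nu\rangle$. *)

(* Defs.v *)
From HB Require Import structures.
From mathcomp Require Import all_boot all_order all_algebra.
From mathcomp Require Import all_classical all_reals all_analysis.
From mathcomp Require Import complex.
Import Order.TTheory GRing.Theory Num.Theory.
Import numFieldNormedType.Exports.
Set Implicit Arguments. Unset Strict Implicit. Unset Printing Implicit Defensive.
Local Open Scope ring_scope.

Section Model.
Variable R : realType.
(* The lattice has dimension d.+1 (>= 1); coordinate [ord0] is the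
   paper's first coordinate nu_1.  Coordinates are 0-based:
   the paper's value k in {1..N_i} is represented by k-1 : 'I_(N i). *)
Variable d : nat.
Variable N : 'I_d.+1 -> nat.

Definition site := {dffun forall i : 'I_d.+1, 'I_(N i)}.
Definition nsites := #|{: site}|.
Notation C := (R[i]).
Notation Mat := ('M[C]_nsites).

Definition nn (nu mu : site) : bool :=
  [exists i, [forall j, (j != i) ==> (nu j == mu j)] &&
             (((nu i).+1 == mu i :> nat) || ((mu i).+1 == nu i :> nat))].

Definition is_succ1 (nu mu : site) : bool :=
  ((mu ord0 : nat) == (nu ord0).+1) && [forall j, (j != ord0) ==> (mu j == nu j)].

Definition inM1 (nu : site) : bool := (nu ord0 : nat) == 0%N.
Definition inMN (nu : site) : bool := (nu ord0 : nat) == (N ord0).-1.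

Definition pnu (nu : site) : Mat := delta_mx (enum_rank nu) (enum_rank nu).
Definition P1 : Mat := \sum_(nu | inM1 nu) pnu nu.
Definition PN : Mat := \sum_(nu | inMN nu) pnu nu.

Definition ham (v : site -> R) : Mat :=
  \matrix_(a, b) (- (nn (enum_val a) (enum_val b))%:R
                  + (a == b)%:R * ((v (enum_val a))%:C)%C).

Definition lind (v : site -> R) (zl zr beta : R) (a : Mat) : Mat :=
  - ('i%C *: (ham v *m a - a *m ham v))
  - (zl%:C)%C *: (P1 *m a + a *m P1)
  - (zr%:C)%C *: (PN *m a + a *m PN)
  + (beta%:C)%C *: (\sum_nu (pnu nu *m a *m pnu nu) - a).

Definition expL (l : Mat -> Mat) (t : R) (X : Mat) : Mat :=
  limn (series (fun k => ((t ^+ k / (k`!)%:R)%:C)%C *: iter k l X)).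

Definition Rplus : set R := `[0%R, +oo[%classic.

Definition integrable0oo (f : R -> C) : Prop :=
  lebesgue_measure.-integrable Rplus (EFin \o (fun t => complex.Re (f t))) /\
  lebesgue_measure.-integrable Rplus (EFin \o (fun t => complex.Im (f t))).

Definition integral0oo (f : R -> C) : C :=
  ((Rintegral lebesgue_measure Rplus (fun t => complex.Re (f t)))%:C
   + 'i * (Rintegral lebesgue_measure Rplus (fun t => complex.Im (f t)))%:C)%C.

Definition Rinf (l : Mat -> Mat) (X : Mat) : Mat :=
  \matrix_(a, b) integral0oo (fun t => expL l t X a b).

Definition current (Rm : Mat) : R :=
  \sum_(nu | inM1 nu) \sum_(mu | is_succ1 nu mu)
     2 * complex.Im (Rm (enum_rank mu) (enum_rank nu)).

End Model.

(* Main.v *)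
Require Import Defs.
From HB Require Import structures.
From mathcomp Require Import all_boot all_order all_algebra.
From mathcomp Require Import all_classical all_reals all_analysis.
From mathcomp Require Import measurable_realfun complex.
From mathcomp Require Import ring lra zify.
Import Order.TTheory GRing.Theory Num.Theory.
Import numFieldNormedType.Exports.
Local Open Scope ring_scope.

(* Let S be the shift in the first coordinate. The hopping matrix is
   S + S^T + Q, where Q acts within the layers and commutes with S, while S S^T
   and S^T S are the complements of P_1 and P_N. Hence the ansatz
   rho = diag r + i c (S - S^T), with r depending only on the first coordinate,
   reduces l(rho) = - X to a linear recursion for r whose two boundary
   conditions determine c; the current of rho is 2 c per site of the first
   layer.
   It remains to see that R_oo = rho, i.e. that e^(tl) is integrable and decays.
   With q(a) = zl * (squared norm of the rows of a indexed by M_1), one has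
   d/dt |a|^2 <= - 2 q(a) along the flow. The entries of a are controlled by
   q(a), q(l a), q(l^2 a), ..., since l propagates information from one layer to
   the next. So V(a) = sum_(k < m) |l^k a|^2 satisfies V' <= - const * V. *)

(** * Lattice geometry *)

Section Sites.
Context {d : nat} {N : 'I_d.+1 -> nat}.
Implicit Types nu mu kap : site N.

Lemma is_succ1P nu mu : reflect
  ((mu ord0 : nat) = (nu ord0).+1 /\ forall j, j != ord0 -> mu j = nu j)
  (is_succ1 nu mu).
Proof.
apply: (iffP andP) => -[e h]; split; [exact/eqP| |exact/eqP|].
  by move=> j /(implyP (forallP h j)) /eqP.
by apply/forallP => j; apply/implyP => /h ->.
Qed.

Lemma site_eqP nu mu : (mu ord0 : nat) = nu ord0 ->
  (forall j, j != ord0 -> mu j = nu j) -> mu = nu.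
Proof.
move=> e0 ej; apply/ffunP => j; have [->|/ej//] := eqVneq j ord0.
exact: val_inj.
Qed.

Lemma is_succ1_uniq nu mu mu' : is_succ1 nu mu -> is_succ1 nu mu' -> mu = mu'.
Proof.
move=> /is_succ1P[e0 ej] /is_succ1P[e0' ej']; apply: site_eqP.
  by rewrite e0 e0'.
by move=> j j0; rewrite ej ?ej'.
Qed.

Lemma is_succ1_inj nu nu' mu : is_succ1 nu mu -> is_succ1 nu' mu -> nu = nu'.
Proof.
move=> /is_succ1P[e0 ej] /is_succ1P[e0' ej']; apply: site_eqP.
  by apply: succn_inj; rewrite -e0 -e0'.
by move=> j j0; rewrite -ej ?ej'.
Qed.

(** Sites are dependent functions, so a coordinate is overwritten through [dfwith]. Both neighbours
    along the first axis are obtained this way. *)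
Lemma site_set0 nu (m : nat) : (m < N ord0)%N -> exists mu,
  (mu ord0 : nat) = m /\ forall j, j != ord0 -> mu j = nu j.
Proof.
move=> mN.
pose f i := @eqtype.dfwith _ (fun i => 'I_(N i)) nu ord0 (Ordinal mN) i.
exists (finfun f); split.
  by rewrite ffunE /f eqtype.dfwith_in.
by move=> j j0; rewrite ffunE /f eqtype.dfwith_out// eq_sym.
Qed.

Lemma exists_pred1 mu : (0 < mu ord0)%N -> exists nu, is_succ1 nu mu.
Proof.
move=> mu0; have [|nu [e0 ej]] := site_set0 mu (mu ord0).-1.
  by rewrite (leq_ltn_trans (leq_pred _)).
exists nu; apply/is_succ1P; rewrite e0 prednK//; split=> // j j0.
by rewrite ej.
Qed.

Lemma exists_succ1 nu : ((nu ord0).+1 < N ord0)%N -> exists mu, is_succ1 nu mu.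
Proof.
by move=> /(site_set0 nu)[mu [e0 ej]]; exists mu; apply/is_succ1P.
Qed.

Lemma nn_sym nu mu : nn nu mu = nn mu nu.
Proof.
apply: eq_existsb => i; rewrite orbC; congr (_ && _).
by apply: eq_forallb => j; rewrite [nu j == _]eq_sym.
Qed.

Lemma is_succ1_nn nu mu : is_succ1 nu mu -> nn nu mu.
Proof.
move=> /is_succ1P[e0 ej]; apply/existsP; exists ord0; rewrite e0 eqxx andbT.
by apply/forallP => j; apply/implyP => /ej ->.
Qed.

Definition nn_layer nu mu := nn nu mu && ((nu ord0 : nat) == mu ord0).

Lemma nnP nu mu :
  nn nu mu = [|| is_succ1 nu mu, is_succ1 mu nu | nn_layer nu mu].
Proof.
apply/idP/or3P => [H|[|/is_succ1_nn|/andP[]//]]; last 2 first.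
- exact: is_succ1_nn.
- by rewrite nn_sym.
have /existsP[i /andP[/forallP ej e]] := H.
have [i0|i0] := eqVneq i ord0.
  rewrite i0 in e ej; have {}ej j : j != ord0 -> nu j = mu j.
    by move=> /(implyP (ej j))/eqP.
  case/orP: e => /eqP e; [constructor 1|constructor 2]; apply/is_succ1P; split=> //.
  by move=> j j0; rewrite ej.
constructor 3; rewrite /nn_layer H /=.
by have /implyP/(_ _)/eqP -> := ej ord0; rewrite // eq_sym.
Qed.

(** The three cases of [nnP] change the first coordinate by 1, by -1 and by 0. They exclude each
    other, so the disjunction becomes a sum. *)
Lemma natr_nn (R : pzSemiRingType) nu mu : (nn nu mu)%:R =
  (is_succ1 nu mu)%:R + (is_succ1 mu nu)%:R + (nn_layer nu mu)%:R :> R.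
Proof.
rewrite nnP /nn_layer; case: (boolP (is_succ1 nu mu)) => [/is_succ1P[e _]|_].
  rewrite e; have /negbTE -> : ~~ is_succ1 mu nu.
    by apply/negP => /is_succ1P[e']; move: e; rewrite e'; lia.
  by rewrite [X in _ && X](_ : _ = false) ?andbF ?addr0//; apply/eqP; lia.
case: (boolP (is_succ1 mu nu)) => [/is_succ1P[e _]|_] /=.
  by rewrite e [X in _ && X](_ : _ = false) ?andbF ?addr0 ?add0r//; apply/eqP; lia.
by rewrite !add0r.
Qed.

Lemma nn_layer_sym nu mu : nn_layer nu mu = nn_layer mu nu.
Proof. by rewrite /nn_layer nn_sym eq_sym. Qed.

(** Translation invariance along the first axis, the reason why Q commutes with S. Equal first
    coordinates rule out [ord0] as the direction of the hop, and the shift leaves all other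
    coordinates alone. *)
Lemma nn_layer_succ1 nu nu' mu mu' : is_succ1 nu nu' -> is_succ1 mu mu' ->
  nn_layer nu' mu' = nn_layer nu mu.
Proof.
move=> /is_succ1P[e0 ej] /is_succ1P[f0 fj].
rewrite /nn_layer e0 f0 eqSS; case: eqP; rewrite ?andbF// => eq0; rewrite !andbT.
apply: eq_existsb => i.
have [->|i0] := eqVneq i ord0.
  by rewrite e0 f0 eq0 !eqn_leq !ltnn !andbF.
rewrite ej// fj//; congr (_ && _); apply: eq_forallb => j.
have [->|j0] := eqVneq j ord0; last by rewrite ej ?fj.
by rewrite -!val_eqE /= e0 f0 eqSS.
Qed.

(** The layer is a product set: a singleton in the first factor, full factors elsewhere. *)
Lemma card_inM1 : (0 < N ord0)%N ->
  #|[pred nu : site N | inM1 nu]| = (\prod_(i | i != ord0) N i)%N.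
Proof.
move=> N0.
transitivity #|setXn (fun i : 'I_d.+1 =>
    [set k : 'I_(N i) | (i == ord0) ==> ((k : nat) == 0%N)])|.
  apply: eq_card => nu; rewrite inE [in RHS]in_setXn.
  apply/idP/forallP => [/eqP h i|/(_ ord0)].
    by rewrite inE; apply/implyP => /eqP ->; rewrite h.
  by rewrite inE eqxx.
rewrite cardsXn (bigD1 ord0)//= [X in (X * _)%N](_ : _ = 1%N) ?mul1n; last first.
  rewrite (_ : [set k | _] = [set Ordinal N0]) ?cards1//.
  by apply/setP => k; rewrite !inE -val_eqE.
apply: eq_bigr => i i0; rewrite (_ : [set k | _] = [set: _]%SET) ?cardsT ?card_ord//.
by apply/setP => k; rewrite !inE (negbTE i0).
Qed.

End Sites.

(** * Entries of the generator *)

Section Lindbladian.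
Context {R : realType} {d : nat} {N : 'I_d.+1 -> nat}.
Variables (zl zr beta : R).
Local Notation n := (nsites N).
Local Notation Mat := 'M[R[i]]_n.
Local Notation idx := ('I_n * 'I_n * bool)%type.
Local Notation st i := (enum_val i : site N).
Local Notation L := (lind (fun _ : site N => 0) zl zr beta).

Definition re_mx (a : Mat) : 'M[R]_n := map_mx (@complex.Re R) a.
Definition im_mx (a : Mat) : 'M[R]_n := map_mx (@complex.Im R) a.

Definition adj_mx : 'M[R]_n := \matrix_(i, j) (nn (st i) (st j))%:R.

(** All dissipative terms of [lind] act entrywise, with this rate. The dephasing term cancels on the
    diagonal, whence the factor [i != j]. *)
Definition damping (i j : 'I_n) : R :=
  zl * ((inM1 (st i))%:R + (inM1 (st j))%:R) +
  zr * ((inMN (st i))%:R + (inMN (st j))%:R) + beta * (i != j)%:R.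

Lemma sum_pnuE (Q : pred (site N)) :
  \sum_(nu | Q nu) pnu R nu = diag_mx (\row_i (Q (st i))%:R).
Proof.
apply/matrixP => i j; rewrite summxE !mxE.
have [<-{j}|ij] := eqVneq i j; last first.
  rewrite mulr0n big1// => nu _; rewrite mxE.
  case: eqP => //= ei; case: eqP => //= ej.
  by rewrite ei ej eqxx in ij.
rewrite mulr1n; case: (boolP (Q (st i))) => Qi.
  rewrite (bigD1 (st i))//= mxE enum_valK eqxx big1 ?addr0// => nu /andP[_ nui].
  rewrite mxE andbb; case: eqP => // ei.
  by rewrite ei enum_rankK eqxx in nui.
rewrite big1// => nu Qnu; rewrite mxE andbb; case: eqP => // ei.
by rewrite ei enum_rankK Qnu in Qi.
Qed.

Lemma sum_pnu_conj (a : Mat) i j :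
  (\sum_nu (pnu R nu *m a *m pnu R nu)) i j = (i == j)%:R * a i j.
Proof.
have pnuE nu : pnu R nu = diag_mx (\row_i (st i == nu)%:R).
  by rewrite -(sum_pnuE (pred1 nu)) big_pred1_eq.
rewrite summxE (bigD1 (st i))//= big1 ?addr0 => [|nu nui].
  rewrite pnuE mul_diag_mx mul_mx_diag !mxE eqxx mul1r mulrC.
  by rewrite (inj_eq enum_val_inj) eq_sym.
by rewrite pnuE mul_diag_mx mul_mx_diag !mxE eq_sym (negbTE nui) !mul0r.
Qed.

(** For zero potential [ham] is minus the adjacency matrix G, so -i[h, a] turns into i[G, a]. *)
Lemma lindE (a : Mat) i j : L a i j =
  'i%C * ((map_mx (real_complex R) adj_mx *m a) i j
         - (a *m map_mx (real_complex R) adj_mx) i j)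
  - ((damping i j)%:C)%C * a i j.
Proof.
have hamE : ham (fun _ : site N => 0 : R) = - map_mx (real_complex R) adj_mx.
  apply/matrixP => k m; rewrite !mxE (_ : (0%:C)%C = 0 :> R[i])// mulr0 addr0.
  by rewrite rmorph_nat.
have P1E : P1 R N = diag_mx (\row_k (inM1 (st k))%:R) by exact: sum_pnuE.
have PNE : PN R N = diag_mx (\row_k (inMN (st k))%:R) by exact: sum_pnuE.
have SE := sum_pnu_conj a i j.
rewrite /lind hamE P1E PNE !mul_diag_mx !mul_mx_diag mulNmx mulmxN opprK.
move: SE; set S := \sum_nu _; set U := map_mx _ _ *m a; set V := a *m _.
move=> SE; rewrite !mxE SE /damping !(rmorphD, rmorphM) !rmorph_nat.
by case: (i == j); rewrite /=; ring.
Qed.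

(** Since [adj_mx] is real, the factor i couples the real part of [L a] to the imaginary part of
    [a]; [im_lindE] is the converse coupling. *)
Lemma re_lindE (a : Mat) i j : complex.Re (L a i j) =
  (im_mx a *m adj_mx - adj_mx *m im_mx a) i j - damping i j * complex.Re (a i j).
Proof.
rewrite lindE.
have -> (z w : R[i]) (c : R) : complex.Re ('i%C * z - (c%:C)%C * w) =
    - complex.Im z - c * complex.Re w.
  by case: z w => [? ?] [? ?] /=; ring.
rewrite raddfB /= opprB !mxE !raddf_sum /=; congr (_ + _ - _).
  by apply: eq_bigr => k _; rewrite !mxE; case: (a i k) => ? ? /=; ring.
by apply: eq_bigr => k _; rewrite !mxE; case: (a k j) => ? ? /=; ring.
Qed.

Lemma im_lindE (a : Mat) i j : complex.Im (L a i j) =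
  (adj_mx *m re_mx a - re_mx a *m adj_mx) i j - damping i j * complex.Im (a i j).
Proof.
rewrite lindE.
have -> (z w : R[i]) (c : R) : complex.Im ('i%C * z - (c%:C)%C * w) =
    complex.Re z - c * complex.Im w.
  by case: z w => [? ?] [? ?] /=; ring.
rewrite raddfB /= !mxE !raddf_sum /=; congr (_ + _ - _).
  by apply: eq_bigr => k _; rewrite !mxE; case: (a k j) => ? ? /=; ring.
by apply: eq_bigr => k _; rewrite !mxE; case: (a i k) => ? ? /=; ring.
Qed.

Lemma lind_linear (c : R[i]) (a b : Mat) : L (c *: a + b) = c *: L a + L b.
Proof.
apply/matrixP => i j; rewrite lindE mulmxDr mulmxDl -scalemxAr -scalemxAl.
rewrite [in RHS]mxE [in RHS]mxE !lindE.
set U := _ *m a; set V := a *m _; set U' := _ *m b; set V' := b *m _.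
by rewrite !mxE; ring.
Qed.

Lemma lind0 : L 0 = 0.
Proof.
have := lind_linear (-1) (0 : Mat) 0.
by rewrite scaler0 addr0 scaleN1r addNr.
Qed.

Lemma lindN (a : Mat) : L (- a) = - L a.
Proof.
by have := lind_linear (-1) a 0; rewrite addr0 !scaleN1r lind0 addr0.
Qed.

End Lindbladian.

(** * Linear flows and exponential decay *)

Local Open Scope classical_set_scope.

Lemma cvg_sum {T : Type} {F : set_system T} {FF : Filter F} {K : numFieldType}
    {V : pseudoMetricNormedZmodType K} {I : Type} (r : seq I) (P : pred I)
    (f : I -> T -> V) (a : I -> V) :
  (forall i, P i -> f i x @[x --> F] --> a i) ->
  \sum_(i <- r | P i) f i x @[x --> F] --> \sum_(i <- r | P i) a i.
Proof.
move=> fa; elim: r => [|i r IH].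
  by rewrite big_nil; under eq_fun do rewrite big_nil; exact: cvg_cst.
rewrite big_cons; under eq_fun do rewrite big_cons.
by case: ifPn => [/fa Pi|_]; [exact: cvgD|exact: IH].
Qed.

(** * Power series of exponential type *)

Section ExponentialSeries.
Context {R : realType}.
Implicit Types (u : nat -> R) (t M C : R).

(** Domination by the exponential series at [C * |t|]. *)
Lemma is_cvg_pseries_fact u M C t : 0 <= C ->
  (forall k, `|u k| <= M * C ^+ k) ->
  cvgn (pseries (fun k => u k / k`!%:R) t).
Proof.
move=> C0 uMC; apply: normed_cvg.
apply: (@series_le_cvg _ _ (fun k => M * exp_coeff (C * `|t|) k)).
- by move=> n /=.
- move=> n; rewrite /exp_coeff /= mulr_ge0 //.
    by have := uMC 0%N; rewrite expr0 mulr1; exact: le_trans.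
  by rewrite divr_ge0// exprn_ge0// mulr_ge0.
- move=> n /=; rewrite /exp_coeff /= !normrM normfV normrX (ger0_norm (ler0n _ _)).
  rewrite exprMn mulrAC !mulrA ler_wpM2r ?invr_ge0//.
  by rewrite ler_wpM2r ?exprn_ge0.
- apply: is_cvg_seriesZ; exact: is_cvg_series_exp_coeff.
Qed.

Lemma is_derive_pseries_fact u M C t : 0 <= C ->
  (forall k, `|u k| <= M * C ^+ k) ->
  is_derive t (1 : R) (fun t => limn (pseries (fun k => u k / k`!%:R) t))
    (limn (pseries (fun k => u k.+1 / k`!%:R) t)).
Proof.
move=> C0 uMC.
have diffsE (v : nat -> R) : pseries_diffs (fun k => v k / k`!%:R) =
    (fun k => v k.+1 / k`!%:R).
  apply/funext => k; rewrite /pseries_diffs factS natrM invfM.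
  by rewrite mulrCA mulVKf.
have bound (v : nat -> R) M' : (forall k, `|v k| <= M' * C ^+ k) ->
    forall k, `|v k.+1| <= M' * C * C ^+ k.
  by move=> vM k; rewrite -mulrA -exprS.
(* Termwise differentiation asks for convergence of the series and of its first two formal
   derivatives at a radius beyond [t]. Each differentiation only shifts [u], which keeps a geometric
   bound. *)
rewrite -diffsE; apply: (@pseries_snd_diffs _ _ (`|t| + 1)).
- exact: (@is_cvg_pseries_fact _ M C).
- rewrite diffsE.
  exact: (is_cvg_pseries_fact (fun k => u k.+1) _ _ _ C0 (bound _ _ uMC)).
- rewrite diffsE (diffsE (fun k => u k.+1)).
  apply: (is_cvg_pseries_fact (fun k => u k.+2) _ _ _ C0).
  exact: (bound (fun k => u k.+1) _ (bound _ _ uMC)).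
- by rewrite (@ger0_norm _ (`|t| + 1)) ?addr_ge0// ltrDl.
Qed.

End ExponentialSeries.

(** * The flow of a linear map in real coordinates *)

Section LinearFlow.
Context {R : realType} {W : Type} {I : finType}.
Variables (phi : W -> I -> R) (L : W -> W) (A : I -> I -> R).
Hypothesis phiL : forall w i, phi (L w) i = \sum_j A i j * phi w j.

Lemma phi_iter_bound w : exists M C : R, 0 <= C /\
  forall k i, `|phi (iter k L w) i| <= M * C ^+ k.
Proof.
(* [B] is the l1 norm of the coordinates of [w]; [D] dominates every absolute row sum of [A]. *)
pose B := \sum_j `|phi w j|; pose D := \sum_i \sum_j `|A i j|.
have B0 : 0 <= B by apply: sumr_ge0 => j _; exact: normr_ge0.
have rowD i : 0 <= \sum_j `|A i j| <= D.
  rewrite sumr_ge0//= /D [leRHS](bigD1 i)//= lerDl.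
  by apply: sumr_ge0 => i' _; exact: sumr_ge0.
have D0 : 0 <= D by apply: sumr_ge0 => i _; case/andP: (rowD i).
exists B, D; split=> //; elim=> [|k IH] i.
  by rewrite expr0 mulr1 /= /B (bigD1 i)//= lerDl sumr_ge0.
rewrite iterS phiL (le_trans (ler_norm_sum _ _ _))//.
apply: (@le_trans _ _ (\sum_j `|A i j| * (B * D ^+ k))).
  by apply: ler_sum => j _; rewrite normrM ler_wpM2l//; exact: IH.
rewrite -mulr_suml exprSr mulrC mulrA ler_wpM2l//.
  by rewrite mulr_ge0 ?exprn_ge0.
by case/andP: (rowD i).
Qed.

(** Coordinate [i] of e^(tL) w. The type [W] carries no structure: linearity is only visible through
    [phi] and [A]. *)
Definition flow (w : W) (i : I) (t : R) : R :=
  limn (pseries (fun k => phi (iter k L w) i / k`!%:R) t).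

Lemma is_cvg_flow w i t :
  cvgn (pseries (fun k => phi (iter k L w) i / k`!%:R) t).
Proof.
have [M [C [C0 MC]]] := phi_iter_bound w.
exact: (@is_cvg_pseries_fact _ _ M C).
Qed.

Lemma is_derive_flow w i t : is_derive t (1 : R) (flow w i) (flow (L w) i t).
Proof.
have [M [C [C0 MC]]] := phi_iter_bound w.
rewrite /flow; under [X in is_derive _ _ _ (limn (pseries X _))]eq_fun
  do rewrite -iterSr.
exact: (@is_derive_pseries_fact _ _ M C t C0 (fun k => MC k i)).
Qed.

(** This is the commutation of e^(tL) with L: the matrix [A] can be pulled out of every partial
    sum. *)
Lemma flowL w i t : flow (L w) i t = \sum_j A i j * flow w j t.
Proof.
rewrite /flow.
have -> : pseries (fun k => phi (iter k L (L w)) i / k`!%:R) t =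
   fun n => \sum_j A i j * pseries (fun k => phi (iter k L w) j / k`!%:R) t n.
  apply/funext => n; rewrite /pseries /series /=.
  under [RHS]eq_bigr do rewrite mulr_sumr.
  rewrite exchange_big /=; apply: eq_bigr => k _.
  rewrite -iterSr iterS phiL !mulr_suml; apply: eq_bigr => j _.
  by rewrite !mulrA.
apply/cvg_lim => //.
apply: cvg_sum => j _.
apply: cvgM; first exact: cvg_cst.
exact: is_cvg_flow.
Qed.

Lemma flow0 w i : flow w i 0 = phi w i.
Proof.
rewrite /flow; apply/cvg_lim => //.
apply: cvg_near_cst.
(* At time 0 only the term of index 0 survives, and every nonempty partial sum contains it. *)
near=> n; rewrite /pseries /series /=.
have n0 : (0 < n)%N by near: n; exists 1%N.
rewrite -(prednK n0) big_nat_recl//= big1 ?addr0 ?fact0 ?expr0 ?divr1 ?mulr1//.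
by move=> k _; rewrite expr0n /= mulr0.
Unshelve. all: by end_near. Qed.

End LinearFlow.

Lemma is_derive_big_sum {R : realType} {I : Type} (r : seq I) (f : I -> R -> R)
    (df : I -> R) (t : R) :
  (forall i, is_derive t (1 : R) (f i) (df i)) ->
  is_derive t (1 : R) (fun x => \sum_(i <- r) f i x) (\sum_(i <- r) df i).
Proof.
move=> fdf; elim: r => [|i r IH].
  rewrite big_nil; under eq_fun do rewrite big_nil; exact: is_derive_cst.
rewrite big_cons; under eq_fun do rewrite big_cons.
exact: is_deriveD.
Qed.

Lemma sqr_sum_le {R : realDomainType} {I : Type} (r : seq I) :
  exists2 C : R, 0 <= C & forall z : I -> R,
    (\sum_(i <- r) z i) ^+ 2 <= C * \sum_(i <- r) z i ^+ 2.
Proof.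
elim: r => [|i r [C C0 IH]].
  by exists 0 => // z; rewrite !big_nil expr0n mul0r.
(* The constant comes from (a + S)^2 <= 2 a^2 + 2 S^2 and the induction hypothesis for S^2. *)
exists (2 + 2 * C) => [|z]; first by rewrite addr_ge0 ?mulr_ge0.
rewrite !big_cons; have := IH z.
have : 0 <= \sum_(j <- r) z j ^+ 2 by apply: sumr_ge0 => j _; exact: sqr_ge0.
set S := \sum_(j <- r) _; set T := \sum_(j <- r) _ => T0 STC.
have := mulr_ge0 C0 (sqr_ge0 (z i)); have := mulr_ge0 C0 T0.
have := sqr_ge0 (z i - S); nra.
Qed.

(** * Exponential decay from partial dissipation and observability *)

Section Lyapunov.
Context {R : realType} {W : Type} {I : finType}.
Variables (phi : W -> I -> R) (L : W -> W) (A : I -> I -> R) (obs : W -> R).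
Hypothesis phiL : forall w i, phi (L w) i = \sum_j A i j * phi w j.
Hypothesis obs_ge0 : forall w, 0 <= obs w.
Hypothesis dissipative : forall w, \sum_i phi w i * phi (L w) i <= - obs w.

(** A quantitative form of observability in the sense of control theory: [obs] is measured along
    finitely many iterates of [L], with constants uniform in [w]. *)
Definition observable (f : W -> R) := exists C m, 0 <= C /\
  forall w, f w ^+ 2 <= C * \sum_(k < m) obs (iter k L w).

Hypothesis phi_observable : forall i, observable (phi ^~ i).

Let norm2 w := \sum_i phi w i ^+ 2.

Let norm2_ge0 w : 0 <= norm2 w.
Proof. by apply: sumr_ge0 => i _; exact: sqr_ge0. Qed.

Lemma norm2_iter_le : exists2 K : R, 0 <= K &
  forall k w, norm2 (iter k L w) <= K ^+ k * norm2 w.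
Proof.
have [C C0 HC] := @sqr_sum_le R I (index_enum I).
pose D := \sum_i \sum_j A i j ^+ 2.
have AD i j : A i j ^+ 2 <= D.
  rewrite /D (bigD1 i)//= (bigD1 j)//= -addrA lerDl addr_ge0//.
    by apply: sumr_ge0 => k _; exact: sqr_ge0.
  by apply: sumr_ge0 => k _; apply: sumr_ge0 => l _; exact: sqr_ge0.
have D0 : 0 <= D.
  by apply: sumr_ge0 => k _; apply: sumr_ge0 => l _; exact: sqr_ge0.
exists (#|I|%:R * (C * D)); first by rewrite !mulr_ge0.
elim=> [|k IH] w; first by rewrite expr0 mul1r.
rewrite iterSr exprS.
apply: (le_trans (IH (L w))).
rewrite [leRHS]mulrAC [leRHS]mulrC ler_wpM2l ?exprn_ge0 ?mulr_ge0//.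
rewrite -[leRHS]mulrA [leRHS]mulr_natl -[leRHS]sumr_const.
apply: ler_sum => i _; rewrite phiL (le_trans (HC _))// -mulrA ler_wpM2l//.
rewrite /norm2 mulr_sumr; apply: ler_sum => j _.
by rewrite exprMn ler_wpM2r// sqr_ge0.
Qed.

Lemma sum_obs_widen m n w : (m <= n)%N ->
  \sum_(k < m) obs (iter k L w) <= \sum_(k < n) obs (iter k L w).
Proof.
move=> mn; rewrite -!(big_mkord xpredT (fun k => obs (iter k L w))).
by rewrite (@big_cat_nat _ _ _ m 0 n)//= lerDl sumr_ge0.
Qed.

(** There are finitely many coordinates, so their constants can be added and the largest depth
    taken. The summand 1 makes the constant invertible. *)
Lemma norm2_observable : exists C m, 0 < C /\
  forall w, norm2 w <= C * \sum_(k < m.+1) obs (iter k L w).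
Proof.
have [C /fin_all_exists[m Cm]] := fin_all_exists phi_observable.
have C0 i : 0 <= C i by case: (Cm i).
exists (1 + \sum_i C i), (\max_i m i)%N; split=> [|w].
  by rewrite ltr_wpDr// sumr_ge0.
rewrite mulrDl mulr_suml /norm2 -[leLHS]add0r lerD ?mul1r ?sumr_ge0//.
apply: ler_sum => i _; have [_ /(_ w) H] := Cm i.
rewrite (le_trans H)// ler_wpM2l// sum_obs_widen//.
by rewrite (leq_trans (leq_bigmax _) (leqnSn _)).
Qed.

Variable y : R -> W.
Hypothesis dy : forall t i,
  is_derive t (1 : R) (fun t => phi (y t) i) (phi (L (y t)) i).

Lemma is_derive_iter k t i : is_derive t (1 : R)
  (fun t => phi (iter k L (y t)) i) (phi (iter k.+1 L (y t)) i).
Proof.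
elim: k i => [|k IH] i; first exact: dy.
under eq_fun do rewrite iterS phiL.
rewrite iterS phiL; exact: is_derive_big_sum.
Qed.

Lemma exponential_decay : exists M c : R, 0 < c /\
  forall t i, 0 <= t -> `|phi (y t) i| <= M * expR (- c * t).
Proof.
have [K K0 HK] := norm2_iter_le.
have [C [m [C0 HC]]] := norm2_observable.
pose V (t : R) : R := \sum_(k < m.+1) norm2 (iter k L (y t)).
(* Boundedness of [L] compares [V] with the norm of [y] alone, up to this factor; the 1 ensures
   positivity. *)
pose K' := 1 + \sum_(k < m.+1) K ^+ k.
have K'0 : 0 < K' by rewrite ltr_wpDr// sumr_ge0// => k _; exact: exprn_ge0.
have VK t : V t <= K' * norm2 (y t).
  rewrite /K' mulrDl mul1r -[leLHS]add0r lerD// mulr_suml.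
  by apply: ler_sum => k _; exact: HK.
have V0 t : 0 <= V t by apply: sumr_ge0.
have dV t : is_derive t (1 : R) V (\sum_(k < m.+1) \sum_i
    2 * (phi (iter k L (y t)) i * phi (L (iter k L (y t))) i)).
  apply: is_derive_big_sum => k; apply: is_derive_big_sum => i.
  have H := is_derive_iter k t i.
  apply: (is_derive_eq (@is_deriveX _ _ _ 2 _ _ _ H)).
  by rewrite expr1 /GRing.scale /= mulrA.
(* The dissipation in all [m.+1] terms is at least 2 / C times [norm2 (y t)] by observability, and
   [norm2 (y t)] is at least V / K'. *)
pose c : R := (C * K')^-1.
have c0 : 0 < c by rewrite invr_gt0 mulr_gt0.
have dV_le t : \sum_(k < m.+1) \sum_i
    2 * (phi (iter k L (y t)) i * phi (L (iter k L (y t))) i) <= - (2 * c) * V t.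
  apply: (@le_trans _ _ (\sum_(k < m.+1) - (2 * obs (iter k L (y t))))).
    apply: ler_sum => k _; rewrite -mulr_sumr -mulrN ler_wpM2l//.
  rewrite sumrN -mulr_sumr mulNr lerN2 -mulrA ler_wpM2l//.
  rewrite /c -ler_pdivlMl ?invr_gt0 ?mulr_gt0// invrK -mulrA.
  rewrite (le_trans (VK t))// mulrCA ler_wpM2l// ?ltW//.
(* Gronwall's argument: the integrating factor makes [g] nonincreasing. *)
pose g (t : R) : R := expR (2 * c * t) * V t.
have dg t : is_derive t (1 : R) g (expR (2 * c * t) *
    (2 * c * V t + \sum_(k < m.+1) \sum_i 2 * (phi (iter k L (y t)) i * phi (L (iter k L (y t))) i))).
  have de : is_derive t (1 : R) (fun t => expR (2 * c * t))
      (2 * c * expR (2 * c * t)).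
    have dl : is_derive t (1 : R) (fun t => 2 * c * t) (2 * c).
      apply: (is_derive_eq (@is_deriveZ _ _ _ id (2 * c) t 1 1 _)).
      by rewrite /GRing.scale /= mulr1.
    apply: (is_derive_eq (@is_derive1_comp _ expR (fun t => 2 * c * t) _ _ _ _ _)).
    by rewrite /GRing.scale /= mulrC.
  apply: (is_derive_eq (is_deriveM de (dV t))).
  by rewrite /GRing.scale /=; ring.
have derivable_g (x : R) : derivable g x 1 by have [] := dg x.
have g_le t : 0 <= t -> g t <= g 0.
  move=> t0; apply: (@ler0_derive1_le_cc _ g 0 t) => //.
  - move=> x _; rewrite derive1E (@derive_val _ _ _ _ _ _ _ (dg x)).
    rewrite mulr_ge0_le0 ?expR_ge0//.
    by rewrite -lerBrDl sub0r -mulNr.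
  - apply: continuous_subspaceT => x.
    by apply: differentiable_continuous; apply/derivable1_diffP; exact: derivable_g.
  - by rewrite in_itv /= lexx t0.
  - by rewrite in_itv /= lexx t0.
(* The square of a coordinate is at most [V], which decays at rate [2 * c]; the square root halves
   the rate. *)
exists (Num.sqrt (V 0)), c; split=> // t i t0.
rewrite -ler_sqr ?nnegrE ?mulr_ge0 ?sqrtr_ge0 ?expR_ge0//.
rewrite exprMn sqr_sqrtr// real_normK ?num_real//.
apply: (@le_trans _ _ (V t)).
  rewrite /V big_ord_recl /= /norm2 (bigD1 i)//= -addrA lerDl addr_ge0//.
    by apply: sumr_ge0 => j _; exact: sqr_ge0.
  by apply: sumr_ge0 => k _; apply: sumr_ge0 => j _; exact: sqr_ge0.
have := g_le t t0; rewrite /g mulr0 expR0 mul1r -expRM_natl.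
rewrite -ler_pdivlMl ?expR_gt0// -expRN mulrC.
by congr (_ <= _ * expR _); ring.
Qed.

End Lyapunov.

(** * Integration of decaying functions over the half line *)

Section HalfLineIntegral.
Context {R : realType}.
Implicit Types (f F : R -> R) (c M : R).
Local Notation mu := (@lebesgue_measure R).

Lemma cvg_expR_decay c : 0 < c -> expR (- c * x) @[x --> +oo] --> 0.
Proof.
move=> c0; apply/cvgrPdist_lt => e e0.
have /cvgrPdist_lt/(_ e e0)[A [Ar HA]] := @cvgr_expR R.
exists (A / c); split; first by rewrite num_real.
by move=> x /=; rewrite ltr_pdivrMr// mulrC mulNr => /HA.
Qed.

Lemma decay_cvg0 F c M : 0 < c ->
  (forall x, 0 <= x -> `|F x| <= M * expR (- c * x)) ->
  F x @[x --> +oo] --> 0.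
Proof.
move=> c0 FM; apply/cvgrPdist_lt => e e0.
have : M * expR (- c * x) @[x --> +oo] --> M * 0.
  by apply: cvgMr; exact: cvg_expR_decay.
rewrite mulr0 => /cvgrPdist_lt/(_ e e0) H.
near=> x; rewrite sub0r normrN (le_lt_trans (FM x _))//.
rewrite (le_lt_trans (ler_norm _))// -normrN -sub0r.
by near: x; exact: H.
Unshelve. all: by end_near. Qed.

(** For a nonnegative integrand the fundamental theorem also yields integrability: the integral of
    the absolute value is the same finite number. *)
Lemma ge0_FTC2y_integrable f F l : (forall x, 0 <= x -> 0 <= f x) ->
  continuous f -> (forall x, is_derive x (1 : R) F (f x)) ->
  F x @[x --> +oo] --> l ->
  mu.-integrable (@Rplus R) (EFin \o f) /\
  Rintegral mu (@Rplus R) f = l - F 0.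
Proof.
move=> f0 cf dF Fl.
have intE : (\int[mu]_(x in @Rplus R) (f x)%:E = l%:E - (F 0)%:E)%E.
  apply: ge0_continuous_FTC2y => //.
  - exact: continuous_subspaceT.
  - apply: cvg_at_right_filter; apply: differentiable_continuous.
    by apply/derivable1_diffP; have [] := dF 0.
  - by move=> x _; rewrite derive1E (@derive_val _ _ _ _ _ _ _ (dF x)).
split; last by rewrite /Rintegral intE.
apply/integrableP; split.
  apply/measurable_EFinP; apply: measurable_funTS.
  exact: continuous_measurable_fun.
suff -> : (\int[mu]_(x in @Rplus R) `|(EFin \o f) x| =
    \int[mu]_(x in @Rplus R) (f x)%:E)%E by rewrite intE -EFinB ltry.
apply: eq_integral => x; rewrite inE /Rplus /= in_itv /= andbT => x0.
by rewrite ger0_norm// f0.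
Qed.

(* Adding [M e^(-ct)] makes the integrand nonnegative, as required by
   [ge0_continuous_FTC2y]. *)
Lemma decay_FTC2y f F c M : 0 < c ->
  continuous f -> (forall x, is_derive x (1 : R) F (f x)) ->
  (forall x, 0 <= x -> `|f x| <= M * expR (- c * x)) ->
  F x @[x --> +oo] --> 0 ->
  mu.-integrable (@Rplus R) (EFin \o f) /\
  Rintegral mu (@Rplus R) f = - F 0.
Proof.
move=> c0 cf dF fM F0.
have M0 : 0 <= M.
  by have := fM 0 (lexx _); rewrite mulr0 expR0 mulr1; exact: le_trans.
(* [H] is the primitive of [h] that vanishes at infinity. *)
pose h x := M * expR (- c * x); pose H x := - (M / c) * expR (- c * x).
have dl (a x : R) : is_derive x (1 : R) (fun x => a * x) a.
  apply: (is_derive_eq (@is_deriveZ _ _ _ id a x 1 1 _)).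
  by rewrite /GRing.scale /= mulr1.
have dexp (a x : R) : is_derive x (1 : R) (fun x => a * expR (- c * x))
    (- (a * c) * expR (- c * x)).
  apply: (is_derive_eq (@is_deriveZ _ _ _ (fun x => expR (- c * x)) a x 1
    (- c * expR (- c * x)) _)).
    apply: (is_derive_eq (@is_derive1_comp _ expR (fun x => - c * x) _ _ _ _ _)).
    by rewrite /GRing.scale /= mulrC.
  by rewrite /GRing.scale /=; ring.
have dH x : is_derive x (1 : R) H (h x).
  apply: (is_derive_eq (dexp _ x)).
  by rewrite /h [- (M / c) * c]mulNr opprK divfK// gt_eqF.
have ch : continuous h.
  move=> x; apply: differentiable_continuous; apply/derivable1_diffP.
  by have [] := dexp M x.
have H0 : H x @[x --> +oo] --> 0.
  rewrite -[X in _ --> X](mulr0 (- (M / c))); apply: cvgMr.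
  exact: cvg_expR_decay.
have [ih Ih] := ge0_FTC2y_integrable h H 0
  (fun x _ => mulr_ge0 M0 (expR_ge0 _)) ch dH H0.
pose g (x : R) : R := f x + h x.
have [ig Ig] : mu.-integrable (@Rplus R) (EFin \o g) /\
    Rintegral mu (@Rplus R) g = 0 - (F 0 + H 0).
  apply: (ge0_FTC2y_integrable _ (fun x => F x + H x)).
  - move=> x x0; have := fM x x0; rewrite ler_norml => /andP[+ _].
    by rewrite -/(h x) -lerBlDr sub0r.
  - by move=> x; apply: continuousD; [exact: cf|exact: ch].
  - by rewrite -[X in _ --> X](addr0 0); apply: cvgD.
have iB : mu.-integrable (@Rplus R)
    ((EFin \o g) \- (EFin \o h))%E.
  by apply: integrableB => //; exact: measurable_itv.
split.
  apply: eq_integrable iB; first exact: measurable_itv.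
  move=> x _ /=.
  by rewrite -EFinB /g addrK.
have -> : Rintegral mu (@Rplus R) f =
    Rintegral mu (@Rplus R) (fun x => g x - h x).
  by apply: eq_Rintegral => x _; rewrite /g addrK.
rewrite RintegralB//; last exact: measurable_itv.
by rewrite Ig Ih; ring.
Qed.

End HalfLineIntegral.

(** * The matrix exponential in real coordinates *)

Lemma cvg_mx {K : numFieldType} {m n : nat} (u : nat -> 'M[K]_(m, n))
    (M : 'M[K]_(m, n)) :
  (forall i j, u k i j @[k --> \oo] --> M i j) -> u k @[k --> \oo] --> M.
Proof.
move=> uM; apply/cvg_ballP => e e0.
have : \forall k \near \oo, forall ij : 'I_m * 'I_n,
    ball (M ij.1 ij.2) e (u k ij.1 ij.2).
  apply: filter_forall => -[i j] /=.
  by have /cvg_ballP/(_ e e0) := uM i j.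
apply: filterS => k H; split=> // i j; exact: (H (i, j)).
Qed.

Lemma cvg_complex {R : realType} (z : nat -> (R[i] : numFieldType))
    (l : (R[i] : numFieldType)) :
  complex.Re (z k) @[k --> \oo] --> complex.Re l ->
  complex.Im (z k) @[k --> \oo] --> complex.Im l ->
  z k @[k --> \oo] --> l.
Proof.
(* In the order of [R[i]], a positive [e] is real, so half of its real part serves as tolerance for
   each component. *)
move=> ua vb; apply/cvgrPdist_lt => e; rewrite ltcE /= => /andP[/eqP Ime e0].
have e2 : 0 < complex.Re e / 2 by rewrite divr_gt0.
move/cvgrPdist_lt/(_ _ e2) : ua; move/cvgrPdist_lt/(_ _ e2) : vb.
apply: filterS2 => k vk uk.
rewrite normc_def ltcE /= Ime eqxx /=.
apply: (@le_lt_trans _ _ (`|complex.Re l - complex.Re (z k)| +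
    `|complex.Im l - complex.Im (z k)|)); last by lra.
rewrite -ler_sqr ?nnegrE ?sqrtr_ge0 ?addr_ge0// sqr_sqrtr ?addr_ge0 ?sqr_ge0//.
rewrite !raddfB /= [leRHS]sqrrD !real_normK ?num_real// -addrA lerD2l lerDr.
by rewrite mulrn_wge0// mulr_ge0.
Qed.

Section MatrixExponential.
Context {R : realType} {d : nat} {N : 'I_d.+1 -> nat}.
Local Notation n := (nsites N).
Local Notation Mat := 'M[R[i]]_n.
Local Notation idx := ('I_n * 'I_n * bool)%type.

(** Complex matrices as real vectors, so that the real theory of [flow] applies; the boolean selects
    the imaginary part. *)
Definition mx_coord (a : Mat) (p : idx) : R :=
  if p.2 then complex.Im (a p.1.1 p.1.2) else complex.Re (a p.1.1 p.1.2).

Variables (l : Mat -> Mat) (A : idx -> idx -> R).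
Hypothesis mx_coordL :
  forall a p, mx_coord (l a) p = \sum_q A p q * mx_coord a q.

Lemma expLE t X : expL l t X = \matrix_(i, j)
  (flow mx_coord l X (i, j, false) t +i* flow mx_coord l X (i, j, true) t)%C.
Proof.
rewrite /expL; apply: (@cvg_lim (matrix (R[i] : numFieldType) n n)).
  exact: norm_hausdorff.
apply: cvg_mx => i j; apply: cvg_complex; rewrite mxE /=.
- suff -> : (fun k => complex.Re (series (fun k =>
      ((t ^+ k / k`!%:R)%:C)%C *: iter k l X) k i j)) =
    pseries (fun k => mx_coord (iter k l X) (i, j, false) / k`!%:R) t.
    exact: (is_cvg_flow _ _ _ mx_coordL).
  apply/funext => k; rewrite /pseries /series /= summxE raddf_sum.
  apply: eq_bigr => m _; rewrite /mx_coord mxE /=.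
  by case: (iter m l X i j) => x y /=; rewrite mul0r subr0; ring.
- suff -> : (fun k => complex.Im (series (fun k =>
      ((t ^+ k / k`!%:R)%:C)%C *: iter k l X) k i j)) =
    pseries (fun k => mx_coord (iter k l X) (i, j, true) / k`!%:R) t.
    exact: (is_cvg_flow _ _ _ mx_coordL).
  apply/funext => k; rewrite /pseries /series /= summxE raddf_sum.
  apply: eq_bigr => m _; rewrite /mx_coord mxE /=.
  by case: (iter m l X i j) => x y /=; rewrite mul0r addr0; ring.
Qed.

Lemma mx_coord_expL t X p : mx_coord (expL l t X) p = flow mx_coord l X p t.
Proof. by case: p => [[i j] []]; rewrite expLE /mx_coord mxE. Qed.

End MatrixExponential.

Local Close Scope classical_set_scope.

(** * Stability of the generator *)

Section ObservableTheory.
Context {R : realType} {W : Type} (L : W -> W) (obs : W -> R).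
Hypothesis obs_ge0 : forall w, 0 <= obs w.
Local Notation observable := (observable L obs).

Lemma observable0 f : (forall w, f w = 0) -> observable f.
Proof.
by move=> f0; exists 0, 0%N; split=> // w; rewrite f0 big_ord0 mulr0 expr0n.
Qed.

Lemma observableD f g : observable f -> observable g ->
  observable (fun w => f w + g w).
Proof.
move=> [C [m [C0 fC]]] [D [k [D0 gD]]].
exists (2 * (C + D)), (maxn m k); split=> [|w].
  by rewrite mulr_ge0// addr_ge0.
have := le_trans (fC w)
  (ler_wpM2l C0 (sum_obs_widen L obs obs_ge0 _ _ w (leq_maxl m k))).
have := le_trans (gD w)
  (ler_wpM2l D0 (sum_obs_widen L obs obs_ge0 _ _ w (leq_maxr m k))).
have := sqr_ge0 (f w - g w).
set S := \sum_(_ < _) _; nra.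
Qed.

Lemma observableZ (c : R) f : observable f -> observable (fun w => c * f w).
Proof.
move=> [C [m [C0 fC]]]; exists (c ^+ 2 * C), m; split=> [|w].
  by rewrite mulr_ge0// sqr_ge0.
by rewrite exprMn -[leRHS]mulrA ler_wpM2l ?sqr_ge0.
Qed.

Lemma observable_sum {I : Type} (r : seq I) (f : I -> W -> R) :
  (forall i, observable (f i)) -> observable (fun w => \sum_(i <- r) f i w).
Proof.
move=> obsf; elim: r => [|i r IH].
  by apply: observable0 => w; rewrite big_nil.
by under eq_fun do rewrite big_cons; exact: observableD.
Qed.

(** Composition with [L] costs one more iterate of [obs]. *)
Lemma observable_iter f : observable f -> observable (fun w => f (L w)).
Proof.
move=> [C [m [C0 fC]]]; exists C, m.+1; split=> // w.
rewrite (le_trans (fC _))// ler_wpM2l// big_ord_recl /= -[leLHS]add0r lerD//.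
by apply: ler_sum => k _; rewrite -iterSr.
Qed.

End ObservableTheory.

Section LindbladianStability.
Context {R : realType} {d : nat} {N : 'I_d.+1 -> nat}.
Variables (zl zr beta : R).
Local Notation n := (nsites N).
Local Notation Mat := 'M[R[i]]_n.
Local Notation idx := ('I_n * 'I_n * bool)%type.
Local Notation st i := (enum_val i : site N).
Local Notation L := (lind (fun _ : site N => 0) zl zr beta).

Lemma mx_coord_lind : exists A : idx -> idx -> R,
  forall a p, mx_coord (L a) p = \sum_q A p q * mx_coord a q.
Proof.
(* The real basis dual to the coordinates [mx_coord]; [A] is the matrix of [L] in it. *)
pose E (q : idx) : Mat := (if q.2 then 'i%C else 1) *: delta_mx q.1.1 q.1.2.
have decomp (a : Mat) : a = \sum_q ((mx_coord a q)%:C)%C *: E q.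
  apply/matrixP => i j; rewrite summxE.
  rewrite -(pair_bigA _ (fun ij b => (((mx_coord a (ij, b))%:C)%C *: E (ij, b)) i j)) /=.
  rewrite (bigD1 (i, j))//= [X in _ + X]big1 ?addr0 => [|[k m] km].
    rewrite big_bool /mx_coord /E /= !mxE !eqxx /= !mulr1.
    by case: (a i j) => x y; simpc.
  rewrite big_bool /E /= !mxE /=; move: km; rewrite xpair_eqE !(eq_sym i, eq_sym j).
  by move=> /negbTE ->; rewrite !mulr0 addr0.
exists (fun p q => mx_coord (L (E q)) p) => a p.
rewrite [in LHS](decomp a).
have coordD (b c : Mat) : mx_coord (b + c) p = mx_coord b p + mx_coord c p.
  by case: p => [[i j] []]; rewrite /mx_coord /= mxE raddfD.
have coordZ (c : R) (b : Mat) : mx_coord ((c%:C)%C *: b) p = c * mx_coord b p.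
  by case: p {coordD} => [[i j] []]; rewrite /mx_coord /= mxE;
    case: (b i j) => x y /=; ring.
elim/big_rec2: _ => [|q x y _ IH].
  by rewrite lind0; case: p {coordD coordZ} => [[i j] []]; rewrite /mx_coord /= mxE.
by rewrite lind_linear coordD coordZ IH mulrC.
Qed.

(** The quantity q(a) of the overview: of the whole damping, only the action of the left reservoir
    on rows is kept. *)
Definition left_weight (a : Mat) : R :=
  zl * \sum_(i | inM1 (st i)) \sum_j
    (complex.Re (a i j) ^+ 2 + complex.Im (a i j) ^+ 2).

Lemma adj_mx_sym : (adj_mx : 'M[R]_n)^T = adj_mx.
Proof. by apply/matrixP => i j; rewrite !mxE nn_sym. Qed.

Hypotheses (zl0 : 0 < zl) (zr0 : 0 <= zr) (beta0 : 0 <= beta).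

Lemma left_weight_ge0 a : 0 <= left_weight a.
Proof.
rewrite /left_weight mulr_ge0 ?(ltW zl0)// sumr_ge0// => i _.
by rewrite sumr_ge0// => j _; rewrite addr_ge0 ?sqr_ge0.
Qed.

Lemma damping_ge (i j : 'I_n) :
  zl * (inM1 (st i))%:R <= damping zl zr beta i j.
Proof.
rewrite /damping -addrA mulrDr -[leLHS]addr0 -[leRHS]addrA lerD2l.
by rewrite !addr_ge0// mulr_ge0 ?addr_ge0// ltW.
Qed.

(** With a = X + iY this is the real part of the Hilbert-Schmidt product of a with i[G, a]. It
    vanishes because the Hamiltonian flow preserves the norm. *)
Lemma trmx_antisym_sum (G X Y : 'M[R]_n) : G^T = G ->
  \sum_i \sum_j (X i j * (Y *m G - G *m Y) i j +
                 Y i j * (G *m X - X *m G) i j) = 0.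
Proof.
move=> GT.
have trE (U V : 'M[R]_n) : \sum_i \sum_j U i j * V i j = \tr (U *m V^T).
  rewrite /mxtrace; apply: eq_bigr => i _; rewrite mxE.
  by apply: eq_bigr => j _; rewrite mxE.
under eq_bigr do rewrite big_split; rewrite big_split /= !trE.
have trB (U V : 'M[R]_n) : (U - V)^T = U^T - V^T.
  by apply/matrixP => i j; rewrite !mxE.
rewrite !trB !trmx_mul GT !mulmxBr !(raddfB (@mxtrace R n)) /=.
have -> : \tr (X *m (G *m Y^T)) = \tr (Y *m (G *m X^T)).
  by rewrite -[LHS]mxtrace_tr !trmx_mul trmxK GT mulmxA.
have -> : \tr (X *m (Y^T *m G)) = \tr (Y *m (X^T *m G)).
  by rewrite -[LHS]mxtrace_tr !trmx_mul trmxK GT -mulmxA mxtrace_mulC -mulmxA.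
by ring.
Qed.

(** The commutator drops out by [trmx_antisym_sum], and [damping_ge] bounds the remaining damping
    from below. *)
Lemma lind_dissipative (a : Mat) :
  \sum_p mx_coord a p * mx_coord (L a) p <= - left_weight a.
Proof.
rewrite -(pair_bigA _ (fun ij b => mx_coord a (ij, b) * mx_coord (L a) (ij, b))) /=.
rewrite -(pair_bigA _ (fun i j => \sum_b mx_coord a (i, j, b) * mx_coord (L a) (i, j, b))) /=.
rewrite /mx_coord /=.
under eq_bigr => i _ do under eq_bigr => j _ do
  rewrite big_bool /= re_lindE im_lindE.
have -> : \sum_i \sum_j
   (complex.Im (a i j) * ((adj_mx *m re_mx a - re_mx a *m adj_mx) i j -
        damping zl zr beta i j * complex.Im (a i j)) +
    complex.Re (a i j) * ((im_mx a *m adj_mx - adj_mx *m im_mx a) i j -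
        damping zl zr beta i j * complex.Re (a i j))) =
  - \sum_i \sum_j damping zl zr beta i j *
     (complex.Re (a i j) ^+ 2 + complex.Im (a i j) ^+ 2).
  have /(congr1 (fun x => x - \sum_i \sum_j damping zl zr beta i j *
    (complex.Re (a i j) ^+ 2 + complex.Im (a i j) ^+ 2))) :=
    trmx_antisym_sum _ (re_mx a) (im_mx a) adj_mx_sym.
  rewrite sub0r => <-.
  rewrite -sumrB; apply: eq_bigr => i _; rewrite -sumrB; apply: eq_bigr => j _.
  rewrite [re_mx a i j]mxE [im_mx a i j]mxE; ring.
rewrite lerN2 /left_weight mulr_sumr [leLHS]big_mkcond /=.
apply: ler_sum => i _; case: ifPn => M1i.
  rewrite mulr_sumr; apply: ler_sum => j _.
  rewrite ler_wpM2r ?addr_ge0 ?sqr_ge0//.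
  by have := damping_ge i j; rewrite M1i mulr1.
apply: sumr_ge0 => j _; apply: mulr_ge0; last by rewrite addr_ge0 ?sqr_ge0.
by apply: le_trans (damping_ge i j); rewrite mulr_ge0// ltW.
Qed.


(** Induction on the layer of the row [i], for all columns at once. Rows in the first layer are part
    of [left_weight]. Beyond it, let [k] be the predecessor of [i]: entry (k, j) of [L a] contains
    the hopping term from (i, j), and its other terms lie in rows already reached. *)
Lemma re_im_observable (i j : 'I_n) :
  observable L left_weight (fun a => complex.Re (a i j)) /\
  observable L left_weight (fun a => complex.Im (a i j)).
Proof.
have obsD := observableD L left_weight left_weight_ge0.
have obsZ := observableZ L left_weight.
have obs_sum := @observable_sum _ _ L left_weight left_weight_ge0.
have obs_iter := observable_iter L left_weight left_weight_ge0.
(* The hypothesis must cover all layers up to [m], as the other neighbours of [k] lie in its own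
   layer or the one before. *)
elim: (st i ord0 : nat) {-2}i (leqnn (st i ord0)) j => [|m IH] {}i im j.
  have M1i : inM1 (st i) by rewrite /inM1 -leqn0.
  have le (a : Mat) : complex.Re (a i j) ^+ 2 + complex.Im (a i j) ^+ 2 <=
      zl^-1 * left_weight a.
    rewrite /left_weight mulKf ?gt_eqF// (bigD1 i)//= (bigD1 j)//= -addrA lerDl.
    rewrite addr_ge0// sumr_ge0// => k _; rewrite ?sumr_ge0// => *;
    by rewrite ?addr_ge0 ?sqr_ge0.
  by split; exists zl^-1, 1%N; rewrite invr_ge0 (ltW zl0); split=> // a;
    rewrite big_ord1 (le_trans _ (le a))// ?lerDl ?lerDr sqr_ge0.
move: im; rewrite leq_eqVlt => /predU1P[im|]; last by rewrite ltnS => /IH.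
have [|nu nui] := exists_pred1 (st i); first by rewrite im.
have [nu0 _] := is_succ1P _ _ nui.
pose k := enum_rank nu; have stk : st k = nu by rewrite enum_rankK.
have km : (st k ord0 <= m)%N by rewrite stk -ltnS -nu0 im.
(* The only neighbour of [k] in the next layer is [i]. *)
have nbr m' : m' != i -> nn (st k) (st m') -> (st m' ord0 <= m)%N.
  move=> m'i; rewrite stk nnP => /or3P[s|/is_succ1P[s _]|/andP[_ /eqP <-]].
  - have /enum_val_inj m'E := is_succ1_uniq _ _ _ s nui.
    by rewrite m'E eqxx in m'i.
  - by rewrite -ltnS -im nu0 s ltnW.
  - by rewrite -stk.
pose g m' : R := if m' == i then 0 else adj_mx k m'.
have adjE (x : R[i] -> R) (a : Mat) : (adj_mx *m map_mx x a) k j =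
    x (a i j) + \sum_m' g m' * x (a m' j).
  rewrite mxE (bigD1 i)//= [in RHS](bigD1 i)//= /g eqxx mul0r add0r.
  rewrite [adj_mx k i]mxE stk is_succ1_nn// mul1r mxE; congr (_ + _).
  by apply: eq_bigr => m' /negbTE ->; rewrite [map_mx _ _ _ _]mxE.
have adjrE (x : R[i] -> R) (a : Mat) : (map_mx x a *m adj_mx) k j =
    \sum_m' adj_mx m' j * x (a k m').
  by rewrite mxE; apply: eq_bigr => m' _; rewrite mulrC [map_mx _ _ _ _]mxE.
have mxB (X Y : 'M[R]_n) : (X - Y) k j = X k j - Y k j by rewrite !mxE.
have obs_g (x : R[i] -> R) : (forall m', (st m' ord0 <= m)%N ->
      observable L left_weight (fun a => x (a m' j))) ->
    observable L left_weight (fun a => \sum_m' g m' * x (a m' j)).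
  move=> obsx; apply: (obs_sum) => m'; rewrite /g.
  case: eqVneq => [_|m'i] /=.
    by apply: observable0 => a; rewrite mul0r.
  rewrite mxE; case: (boolP (nn _ _)) => [nnm'|_]; last first.
    by apply: observable0 => a; rewrite mul0r.
  by apply: (obsZ); apply: obsx; exact: nbr.
split.
(* The formula for the imaginary part of [L a] at (k, j) is solved for the one unknown entry. *)
- have -> : (fun a : Mat => complex.Re (a i j)) = (fun a =>
      complex.Im (L a k j) + (damping zl zr beta k j * complex.Im (a k j) +
      (\sum_m' adj_mx m' j * complex.Re (a k m') +
      (-1) * \sum_m' g m' * complex.Re (a m' j)))).
    by apply/funext => a; rewrite im_lindE mxB adjE adjrE; ring.
  apply: (obsD); first by apply: (obs_iter (fun a => complex.Im (a k j)));
    have [] := IH k km j.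
  apply: (obsD); first by apply: (obsZ); have [] := IH k km j.
  apply: (obsD); last by apply: (obsZ); apply: (obs_g) => m' /IH/(_ j)[].
  by apply: (obs_sum) => m'; apply: (obsZ); have [] := IH k km m'.
- have -> : (fun a : Mat => complex.Im (a i j)) = (fun a =>
      (-1) * complex.Re (L a k j) + (- damping zl zr beta k j * complex.Re (a k j) +
      (\sum_m' adj_mx m' j * complex.Im (a k m') +
      (-1) * \sum_m' g m' * complex.Im (a m' j)))).
    by apply/funext => a; rewrite re_lindE mxB adjE adjrE; ring.
  apply: (obsD); first by apply: (obsZ);
    apply: (obs_iter (fun a => complex.Re (a k j))); have [] := IH k km j.
  apply: (obsD); first by apply: (obsZ); have [] := IH k km j.
  apply: (obsD); last by apply: (obsZ); apply: (obs_g) => m' /IH/(_ j)[].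
  by apply: (obs_sum) => m'; apply: (obsZ); have [] := IH k km m'.
Qed.

End LindbladianStability.

(** * Integrating the flow of the generator *)

Section LindbladianFlow.
Context {R : realType} {d : nat} {N : 'I_d.+1 -> nat}.
Variables (zl zr beta : R).
Hypotheses (zl0 : 0 < zl) (zr0 : 0 <= zr) (beta0 : 0 <= beta).
Local Notation Mat := 'M[R[i]]_(nsites N).
Local Notation L := (lind (fun _ : site N => 0) zl zr beta).

Lemma is_derive_expL (a : Mat) p (t : R) :
  is_derive t (1 : R) (fun t => mx_coord (expL L t a) p)
    (mx_coord (expL L t (L a)) p).
Proof.
have [A mx_coordL] := @mx_coord_lind _ _ N zl zr beta.
under eq_fun do rewrite (mx_coord_expL _ _ mx_coordL).
rewrite (mx_coord_expL _ _ mx_coordL).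
exact: is_derive_flow mx_coordL _ _ _.
Qed.

Lemma expL_lind (a : Mat) t p :
  mx_coord (expL L t (L a)) p = mx_coord (L (expL L t a)) p.
Proof.
have [A mx_coordL] := @mx_coord_lind _ _ N zl zr beta.
rewrite (mx_coord_expL _ _ mx_coordL) (flowL _ _ _ mx_coordL) mx_coordL.
by apply: eq_bigr => q _; rewrite (mx_coord_expL _ _ mx_coordL).
Qed.

Lemma expL_decay (a : Mat) : exists M c : R, 0 < c /\
  forall t p, 0 <= t -> `|mx_coord (expL L t a) p| <= M * expR (- c * t).
Proof.
have [A mx_coordL] := @mx_coord_lind _ _ N zl zr beta.
apply: (@exponential_decay _ _ _ _ L A (left_weight zl) mx_coordL).
- exact: left_weight_ge0.
- exact: lind_dissipative.
- move=> [[i j] b]; have [re im] := re_im_observable zl zr beta zl0 i j.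
  by case: b.
- move=> t p; rewrite -expL_lind; exact: is_derive_expL.
Qed.

(** The integrand is the derivative of e^(tL) a. Decay of e^(tL) L a gives integrability; decay of
    e^(tL) a removes the boundary term at infinity. *)
Lemma expL_integral (a : Mat) p :
  lebesgue_measure.-integrable (@Rplus R)
    (EFin \o (fun t => mx_coord (expL L t (L a)) p)) /\
  Rintegral lebesgue_measure (@Rplus R)
    (fun t => mx_coord (expL L t (L a)) p) = - mx_coord a p.
Proof.
have [A mx_coordL] := @mx_coord_lind _ _ N zl zr beta.
have [M [c [c0 fM]]] := expL_decay (L a).
have [M' [c' [c'0 FM]]] := expL_decay a.
have -> : - mx_coord a p = - mx_coord (expL L 0 a) p.
  by rewrite (mx_coord_expL _ _ mx_coordL) flow0.
apply: (@decay_FTC2y _ _ (fun t => mx_coord (expL L t a) p) c M c0).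
- move=> t; apply: differentiable_continuous; apply/derivable1_diffP.
  by have [] := is_derive_expL (L a) p t.
- by move=> t; exact: is_derive_expL.
- by move=> t t0; exact: fM.
- by apply: decay_cvg0 c'0 _ => t t0; exact: FM.
Qed.

(** This replaces the computation of the integral by the solution of a linear equation for the
    generator. *)
Lemma Rinf_lind (a : Mat) :
  (forall i j, integrable0oo (fun t => expL L t (L a) i j)) /\
  Rinf L (L a) = - a.
Proof.
split=> [i j|].
  split.
    by have [] := expL_integral a (i, j, false).
  by have [] := expL_integral a (i, j, true).
apply/matrixP => i j; rewrite !mxE /integral0oo.
have [_ reE] := expL_integral a (i, j, false).
have [_ imE] := expL_integral a (i, j, true).
rewrite /mx_coord /= in reE imE; rewrite reE imE.
by case: (a i j) => x y /=; simpc.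
Qed.

End LindbladianFlow.

(** * The steady state *)

Section StationaryState.
Context {R : realType} {d : nat} {N : 'I_d.+1 -> nat}.
Local Notation n := (nsites N).
Local Notation st i := (enum_val i : site N).

Implicit Types i j k : 'I_n.

(* Maps [e_nu] to [e_(nu_+)]. *)
Definition shift_mx : 'M[R]_n := \matrix_(i, j) (is_succ1 (st j) (st i))%:R.
Definition layer_mx : 'M[R]_n := \matrix_(i, j) (nn_layer (st i) (st j))%:R.

Lemma adj_mxE : adj_mx = shift_mx + shift_mx^T + layer_mx.
Proof.
apply/matrixP => i j; rewrite !mxE natr_nn; congr (_ + _).
by rewrite addrC.
Qed.

Lemma sum_pred1 (f : 'I_n -> R) i i0 : is_succ1 (st i0) (st i) ->
  \sum_k (is_succ1 (st k) (st i))%:R * f k = f i0.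
Proof.
move=> s; rewrite (bigD1 i0)//= s mul1r big1 ?addr0// => k ki0.
case: (boolP (is_succ1 _ _)) => [s'|]; last by rewrite mul0r.
by have /enum_val_inj ke := is_succ1_inj _ _ _ s' s; rewrite ke eqxx in ki0.
Qed.

Lemma sum_succ1 (f : 'I_n -> R) i i0 : is_succ1 (st i) (st i0) ->
  \sum_k (is_succ1 (st i) (st k))%:R * f k = f i0.
Proof.
move=> s; rewrite (bigD1 i0)//= s mul1r big1 ?addr0// => k ki0.
case: (boolP (is_succ1 _ _)) => [s'|]; last by rewrite mul0r.
by have /enum_val_inj ke := is_succ1_uniq _ _ _ s' s; rewrite ke eqxx in ki0.
Qed.

Lemma pred1_caseP i :
  (0 < st i ord0)%N /\ (exists k : 'I_n, is_succ1 (st k) (st i)) \/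
  st i ord0 = 0%N :> nat /\ forall mu, is_succ1 mu (st i) = false.
Proof.
have [i0|i0] := posnP (st i ord0); [right|left]; split=> //.
  by move=> mu; apply/negbTE/negP => /is_succ1P[]; rewrite i0.
have [mu s] := exists_pred1 _ i0; exists (enum_rank mu).
by rewrite enum_rankK.
Qed.

Lemma succ1_caseP i :
  ((st i ord0).+1 < N ord0)%N /\ (exists k : 'I_n, is_succ1 (st i) (st k)) \/
  st i ord0 = (N ord0).-1 :> nat /\ forall mu, is_succ1 (st i) mu = false.
Proof.
have [lt|ge] := ltnP (st i ord0).+1 (N ord0); [left|right]; split=> //.
- have [mu s] := exists_succ1 _ lt; exists (enum_rank mu).
  by rewrite enum_rankK.
- by have := ltn_ord (st i ord0); lia.
- move=> mu; apply/negbTE/negP => /is_succ1P[e _].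
  by have := ltn_ord (mu ord0); rewrite e; lia.
Qed.

Lemma shift_mulT i j : (shift_mx *m shift_mx^T) i j =
  ((i == j) && ~~ inM1 (st i))%:R.
Proof.
rewrite mxE; under eq_bigr do rewrite !mxE.
have [[i0 [k s]]|[i0 s]] := pred1_caseP i; last first.
  rewrite /inM1 i0 eqxx andbF big1// => k _.
  by rewrite s mul0r.
rewrite (sum_pred1 (fun k => (is_succ1 (st k) (st j))%:R) _ _ s).
rewrite /inM1 -lt0n i0 andbT.
have [<-|ij] := eqVneq i j; first by rewrite s.
case: (boolP (is_succ1 _ _)) => // s'.
by have /enum_val_inj ije := is_succ1_uniq _ _ _ s s'; rewrite ije eqxx in ij.
Qed.

Lemma shiftT_mul i j : (shift_mx^T *m shift_mx) i j =
  ((i == j) && ~~ inMN (st i))%:R.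
Proof.
rewrite mxE; under eq_bigr do rewrite !mxE.
have [[i0 [k s]]|[i0 s]] := succ1_caseP i; last first.
  rewrite /inMN i0 eqxx andbF big1// => k _.
  by rewrite s mul0r.
rewrite (sum_succ1 (fun k => (is_succ1 (st j) (st k))%:R) _ _ s).
rewrite /inMN (_ : (_ != _) = true) ?andbT; last by apply/eqP; lia.
have [<-|ij] := eqVneq i j; first by rewrite s.
case: (boolP (is_succ1 _ _)) => // s'.
by have /enum_val_inj ije := is_succ1_inj _ _ _ s s'; rewrite ije eqxx in ij.
Qed.

(** At (i, j) the left side involves the predecessor of [i], the right side the successor of [j]. If
    both exist, translation invariance applies; otherwise first coordinates differ and both sides
    vanish. *)
Lemma shift_layerC : shift_mx *m layer_mx = layer_mx *m shift_mx.
Proof.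
apply/matrixP => i j; rewrite !mxE.
under eq_bigr do rewrite !mxE.
under [RHS]eq_bigr do rewrite !mxE mulrC.
have [[i0 [k s]]|[i0 s]] := pred1_caseP i; last first.
  rewrite !big1// => k _; first by
    case: (boolP (is_succ1 _ _)) => [/is_succ1P[e _]|_]; rewrite ?mul0r// /nn_layer i0 e andbF mulr0.
  by rewrite s mul0r.
rewrite (sum_pred1 (fun k => (nn_layer (st k) (st j))%:R) _ _ s).
have [[j0 [m s']]|[j0 s']] := succ1_caseP j.
  rewrite (sum_succ1 (fun k => (nn_layer (st i) (st k))%:R) _ _ s').
  by rewrite (nn_layer_succ1 _ _ _ _ s s').
rewrite big1 => [|m _]; last by rewrite s' mul0r.
rewrite /nn_layer j0; have [e _] := is_succ1P _ _ s.
have := ltn_ord (st i ord0); rewrite e => lt.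
by rewrite [X in _ && X](_ : _ = false) ?andbF//; apply/eqP; lia.
Qed.

Lemma layer_mx_sym : layer_mx^T = layer_mx.
Proof. by apply/matrixP => i j; rewrite !mxE nn_layer_sym. Qed.

Lemma shiftT_layerC : shift_mx^T *m layer_mx = layer_mx *m shift_mx^T.
Proof. by rewrite -layer_mx_sym -!trmx_mul shift_layerC. Qed.

(** By [shift_mulT] and [shiftT_mul] the right side is 2 (P_N - P_1): the current has no divergence
    in the bulk. *)
Lemma shift_adj_commutator :
  (shift_mx - shift_mx^T) *m adj_mx - adj_mx *m (shift_mx - shift_mx^T) =
  (shift_mx *m shift_mx^T - shift_mx^T *m shift_mx) *+ 2.
Proof.
rewrite adj_mxE !mulmxDl !mulmxDr !mulNmx !mulmxN shift_layerC shiftT_layerC.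
move: (_ *m _) (_ *m _) (_ *m _) (_ *m _) (_ *m _) (_ *m _) => A1 A2 A3 A4 A5 A6.
by apply/matrixP => i j; rewrite !mxE; ring.
Qed.

Variables (ain_l aout_l ain_r aout_r beta : R).
Hypothesis N2 : (2 <= N ord0)%N.
Local Notation zl := (ain_l + aout_l).
Local Notation zr := (ain_r + aout_r).
Hypotheses (zl0 : 0 < zl) (zr0 : 0 < zr) (beta0 : 0 <= beta).
Local Notation L := (lind (fun _ : site N => 0) zl zr beta).

Let den := (beta * ((N ord0)%:R - 1) + zl + zr) * zl * zr + zl + zr.
(* The value of c forced by [density_first] and [density_last]. *)
Definition half_current := (ain_l * aout_r - aout_l * ain_r) / den.
Local Notation c := half_current.

(** The solution of the recursion started from the left boundary condition. Each bond lowers it by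
    [c] times its damping: [beta] always, [zl] on the first bond, [zr] on the last. *)
Definition density (k : nat) : R := (ain_l - c) / zl -
  c * (beta * k%:R + zl * (0 < k)%N%:R + zr * (k == (N ord0).-1)%:R).

Definition steady_state : 'M[R[i]]_n := \matrix_(i, j)
  ((i == j)%:R * density (st i ord0) +i*
   (c * (shift_mx i j - shift_mx j i)))%C.

Lemma den_gt0 : 0 < den.
Proof.
have b0 : 0 <= beta * ((N ord0)%:R - 1).
  by rewrite mulr_ge0// subr_ge0 ler1n (leq_trans _ N2).
rewrite /den addr_gt0// ltr_wpDl// mulr_ge0 ?(ltW zr0)// mulr_ge0 ?(ltW zl0)//.
by rewrite addr_ge0 ?(ltW zr0)// addr_ge0 ?(ltW zl0).
Qed.

Lemma density_first : zl * density 0 = ain_l - c.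
Proof.
rewrite /density /= mulr0 mulr0 (_ : (0 == _)%N = false); last by apply/eqP; lia.
by rewrite !(mulr0, addr0) subr0 mulrC divfK// gt_eqF.
Qed.

(** This condition fixes [c]: after clearing [zl] it reads c den = zr ain_l - zl ain_r, where the
    products of the two incoming rates cancel. *)
Lemma density_last : zr * density (N ord0).-1 = ain_r + c.
Proof.
rewrite /density eqxx (_ : (0 < _)%N); last by lia.
rewrite /= !mulr1 -subn1 natrB; last by rewrite (leq_trans _ N2).
have := den_gt0; have := zl0; have := zr0.
rewrite /half_current /den => ? ? ?; field.
by rewrite !gt_eqF.
Qed.

Lemma density_step (k : nat) : (k.+1 < N ord0)%N -> density k - density k.+1 =
  c * (beta + zl * (k == 0)%N%:R + zr * (k.+1 == (N ord0).-1)%:R).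
Proof.
move=> kN; rewrite /density (_ : (k == (N ord0).-1) = false); last by apply/eqP; lia.
by rewrite -natr1 lt0n; case: (k == 0)%N => /=; ring.
Qed.

Lemma re_steady : re_mx steady_state = diag_mx (\row_i density (st i ord0)).
Proof.
apply/matrixP => i j; rewrite !mxE /=.
by case: eqP => _; rewrite ?mul1r ?mul0r.
Qed.

Lemma im_steady : im_mx steady_state = c *: (shift_mx - shift_mx^T).
Proof. by apply/matrixP => i j; rewrite !mxE /=. Qed.

Lemma sourceE i j :
  (((2 * ain_l)%:C)%C *: P1 R N + ((2 * ain_r)%:C)%C *: PN R N) i j =
  (((i == j)%:R * (2 * ain_l * (inM1 (st i))%:R +
     2 * ain_r * (inMN (st i))%:R))%:C)%C.
Proof.
have P1E : P1 R N = diag_mx (\row_k (inM1 (st k))%:R) by exact: sum_pnuE.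
have PNE : PN R N = diag_mx (\row_k (inMN (st k))%:R) by exact: sum_pnuE.
rewrite P1E PNE !mxE !(rmorphD, rmorphM) !rmorph_nat.
by case: eqVneq => [->|_] /=; ring.
Qed.

(** The real part is diagonal and gives the two boundary conditions at the end layers. In the
    imaginary part, the density drop along each bond of the first direction balances the damping of
    the current. *)
Lemma lind_steady : L steady_state =
  - (((2 * ain_l)%:C)%C *: P1 R N + ((2 * ain_r)%:C)%C *: PN R N).
Proof.
have complexP (z w : R[i]) : complex.Re z = complex.Re w ->
    complex.Im z = complex.Im w -> z = w.
  by case: z w => ? ? [? ?] /= -> ->.
apply/matrixP => i j; rewrite [RHS]mxE sourceE.
have siE : steady_state i j = ((i == j)%:R * density (st i ord0) +i*
   (c * (shift_mx i j - shift_mx j i)))%C by rewrite mxE.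
apply: complexP.
- rewrite re_lindE siE im_steady -scalemxAl -scalemxAr -scalerBr.
  rewrite shift_adj_commutator.
  have -> (A B : 'M[R]_n) : (c *: ((A - B) *+ 2)) i j = 2 * c * (A i j - B i j).
    by rewrite !mxE; ring.
  rewrite shift_mulT shiftT_mul /=.
  have [<-{j siE}|ij] := eqVneq i j; last by rewrite /=; ring.
  rewrite /= /damping eqxx /=.
  have M1N : inM1 (st i) -> inMN (st i) -> False.
    by rewrite /inM1 /inMN => /eqP -> /eqP; lia.
  case: (boolP (inM1 (st i))) => [M1|_]; case: (boolP (inMN (st i))) => [MN|_] /=.
  + by have := M1N M1 MN.
  + by have := density_first; rewrite (eqP M1) => ?; nra.
  + by have := density_last; rewrite -(eqP MN) => ?; nra.
  + by ring.
- rewrite im_lindE siE re_steady mul_mx_diag mul_diag_mx !mxE /= oppr0.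
  rewrite !natr_nn.
  have step (k m : 'I_n) : is_succ1 (st k) (st m) ->
    density (st k ord0) - density (st m ord0) = c * damping zl zr beta k m.
    move=> s; have [e _] := is_succ1P _ _ s.
    have lt := ltn_ord (st m ord0).
    rewrite e density_step -?e// /damping /inM1 /inMN e.
    rewrite (_ : (k == m) = false); last by
      by apply/eqP => km; move: e; rewrite km => /n_Sn.
    rewrite (_ : (st k ord0 == (N ord0).-1 :> nat) = false); last by
      apply/eqP; lia.
    by rewrite /=; ring.
  have damping_sym : damping zl zr beta i j = damping zl zr beta j i.
    by rewrite /damping [i == j]eq_sym; ring.
  have sasym (nu mu : site N) : is_succ1 nu mu -> is_succ1 mu nu = false.
    move=> /is_succ1P[e _]; apply/negbTE/negP => /is_succ1P[e' _].
    by move: e'; rewrite e; lia.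
  have slayer (nu mu : site N) : is_succ1 nu mu ->
      nn_layer nu mu = false /\ nn_layer mu nu = false.
    move=> /is_succ1P[e _]; rewrite nn_layer_sym; split;
      by rewrite /nn_layer [X in _ && X](_ : _ = false) ?andbF//; apply/eqP; lia.
  case: (boolP (is_succ1 (st i) (st j))) => [s|_].
    have := step _ _ s; rewrite (sasym _ _ s); have [-> _] := slayer _ _ s.
    move=> /eqP; rewrite subr_eq => /eqP -> /=.
    by rewrite !(mulr0n, mulr1n); ring.
  case: (boolP (is_succ1 (st j) (st i))) => [s|_].
    have := step _ _ s; have [_ ->] := slayer _ _ s.
    rewrite -damping_sym.
    move=> /eqP; rewrite subr_eq => /eqP -> /=.
    by rewrite !(mulr0n, mulr1n); ring.
  (* Any remaining hop stays in its layer, where the density is constant. *)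
  rewrite /nn_layer; case: (eqVneq (st i ord0 : nat) (st j ord0)) => [->|_];
    by rewrite ?andbF !(mulr0n, mulr1n); ring.
Qed.

(** Each site of the first layer has exactly one successor, and this bond contributes [2 * c]. *)
Lemma current_steady : (forall i : 'I_d.+1, (0 < N i)%N) ->
  current steady_state =
  2 * (ain_l * aout_r - aout_l * ain_r) * (\prod_(m | m != ord0) (N m)%:R) / den.
Proof.
move=> N0; rewrite /current.
transitivity (\sum_(nu in [pred nu : site N | inM1 nu]) 2 * c); last first.
  rewrite sumr_const card_inM1 ?N0// -[LHS]mulr_natr natr_prod /half_current.
  by ring.
apply: eq_big => [nu|nu nu1]; first by rewrite inE.
have [|mu s] := exists_succ1 nu; first by rewrite (eqP nu1).
rewrite (bigD1 mu)//= big1 => [|mu' /andP[s' ne]]; last first.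
  by rewrite (is_succ1_uniq _ _ _ s' s) eqxx in ne.
rewrite !mxE /= !enum_rankK s (_ : is_succ1 mu nu = false) ?subr0 ?mulr1 ?addr0//.
apply/negbTE/negP => /is_succ1P[e _]; have [e' _] := is_succ1P _ _ s.
by move: e; rewrite e'; lia.
Qed.

End StationaryState.

Theorem theorem4p1 (R : realType) (d : nat) (N : 'I_d.+1 -> nat)
    (ain_l aout_l ain_r aout_r beta : R) :
  (forall i, (0 < N i)%N) -> (2 <= N ord0)%N ->
  0 <= ain_l -> 0 <= aout_l -> 0 <= ain_r -> 0 <= aout_r -> 0 <= beta ->
  0 < ain_l + aout_l -> 0 < ain_r + aout_r ->
  let zl := ain_l + aout_l in
  let zr := ain_r + aout_r in
  let l := lind (fun _ : site N => 0) zl zr beta in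
  let X := ((2 * ain_l)%:C)%C *: P1 R N + ((2 * ain_r)%:C)%C *: PN R N in
  (forall a b, integrable0oo (fun t => expL l t X a b)) /\
  current (Rinf l X) =
    2 * (ain_l * aout_r - aout_l * ain_r) * (\prod_(n | n != ord0) (N n)%:R)
    / ((beta * ((N ord0)%:R - 1) + zl + zr) * zl * zr + zl + zr).
Proof.
move=> N0 N2 _ _ _ _ beta0 zl0 zr0 zl zr l X.
pose rho := steady_state ain_l aout_l ain_r aout_r beta : 'M[R[i]]_(nsites N).
(* The source is the image of [- rho], so [Rinf_lind] evaluates the integral to [rho]. *)
have LX : l (- rho) = X.
  by rewrite /l lindN lind_steady// opprK.
rewrite -LX.
have [int ->] := Rinf_lind zl zr beta zl0 (ltW zr0) beta0 (- rho).
split; first exact: int.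
by rewrite opprK current_steady.
Qed.
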